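(* Let $X$ be a Banach space, $(M,\mathfrak{M},\mu)$ a measure space containing a measurable set $A$ with $0<\mu(A)<\infty$, $1<p<\infty$ and $n\ge2$. Then $\ell_\infty^n$ is representable in $X$ if and only if $\ell_\infty^n$ is representable in the Lebesgue–Bochner space $L_p(M,\mathfrak{M},\mu;X)$.
   Context: $\ell_\infty^n$ is $\mathbb{R}^n$ with the maximum norm. A Banach space $Y$ is representable in $X$ if for each $\lambda>1$ there is a bounded linear map $T:Y\to X$ with $\|y\|\le\|Ty\|\le\lambda\|y\|$ for all $y\in Y$. *)

(* Defs.v *)
From HB Require Import structures.
From mathcomp Require Import all_boot all_order all_algebra.
From mathcomp Require Import all_classical all_reals all_analysis.
Set Implicit Arguments. Unset Strict Implicit. Unset Printing Implicit Defensive.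
Import Order.TTheory GRing.Theory Num.Theory.
Import numFieldNormedType.Exports.
Local Open Scope classical_set_scope.
Local Open Scope ring_scope.

Definition linf_norm {R : realType} {n : nat} (y : 'rV[R]_n) : R :=
  \big[Num.max/0]_(i < n) `|y ord0 i|.

Definition simple_fun {d} {M : measurableType d} {R : realType}
    {X : normedModType R} (g : M -> X) : Prop :=
  exists s : seq (set M * X),
    (forall j, j \in s -> measurable j.1) /\
    g = fun x => \sum_(j <- s) (\1_(j.1) x : R) *: j.2.

Definition strongly_measurable {d} {M : measurableType d} {R : realType}
    {X : normedModType R} (f : M -> X) : Prop :=
  exists g : nat -> M -> X, (forall k, simple_fun (g k)) /\
    forall x, (fun k => g k x) @ \oo --> f x.

Definition bochner_norm {d} {M : measurableType d} {R : realType}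
    {X : normedModType R} (mu : {measure set M -> \bar R}) (p : R)
    (f : M -> X) : \bar R :=
  Lnorm mu p%:E (fun x => (`|f x|)%:E).

Definition in_Lp {d} {M : measurableType d} {R : realType}
    {X : normedModType R} (mu : {measure set M -> \bar R}) (p : R)
    (f : M -> X) : Prop :=
  strongly_measurable f /\ (bochner_norm mu p f < +oo)%E.

Definition linf_representable {R : realType} (n : nat) (X : normedModType R)
  : Prop :=
  forall lam : R, 1 < lam ->
    exists T : 'rV[R]_n -> X, linear T /\
      forall y, linf_norm y <= `|T y| <= lam * linf_norm y.

(* ell_infty^n representable in L_p(M, mu; X); linear maps into L_p are
   represented by (pointwise) linear maps into functions taking values in L_p *)
Definition linf_representable_Lp {R : realType} (n : nat) {d}
    {M : measurableType d} (X : normedModType R)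
    (mu : {measure set M -> \bar R}) (p : R) : Prop :=
  forall lam : R, 1 < lam ->
    exists T : 'rV[R]_n -> (M -> X),
      (forall y, in_Lp mu p (T y)) /\
      (forall (a : R) (u v : 'rV[R]_n), T (a *: u + v) = fun x => a *: T u x + T v x) /\
      forall y, ((linf_norm y)%:E <= bochner_norm mu p (T y)
                 <= (lam * linf_norm y)%:E)%E.

(* Main.v *)
(* If ell_infty^n is almost isometrically embedded in L_p(X) by T, each point x
   of M gives a seminorm N_x(y) = |T y x| on R^n. Since e_i is, up to signs, the
   average of the sign vectors, N_x(e_i) is at most the average of the N_x(e)
   over the sign vectors e, and the tangent inequality of t |-> t^p at N_x(e_i)
   yields N_x(e_i)^p <= average of the N_x(e)^p, with a gain proportional to
   G^p, G = max_e N_x(e), as soon as N_x(e_i) <= r G with r < 1. A gain at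
   every x would, after integration, contradict |T e_i| >= 1 and |T e| close
   to 1. So some x has N_x(e_i) > r G for all i, and convexity then forces
   (2 r - 1) G |y| <= N_x(y) <= G |y|: a multiple of y |-> T y x is the required
   embedding in X. *)
Require Import Defs.
From HB Require Import structures.
From mathcomp Require Import all_boot all_order all_algebra.
From mathcomp Require Import all_classical all_reals all_analysis.
From mathcomp Require Import measurable_realfun ring lra.
Set Implicit Arguments.
Unset Strict Implicit.
Unset Printing Implicit Defensive.
Import Order.TTheory GRing.Theory Num.Theory.
Import numFieldNormedType.Exports.
Local Open Scope classical_set_scope.
Local Open Scope ring_scope.

(** * Tangent inequalities for the function t^p *)

Section powR_tangent.
Context {R : realType}.
Implicit Types p r s t G : R.

(** This is Young's inequality for t and s^(p - 1), with conjugate exponents p and p / (p - 1),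
    multiplied by p. *)
Lemma powR_tangent p s t : 1 < p -> 0 <= s -> 0 <= t ->
  s `^ p + p * s `^ (p - 1) * (t - s) <= t `^ p.
Proof.
move=> p1 s0 t0.
have p0 : 0 < p by lra.
have pB0 : 0 < p - 1 by lra.
have q0 : 0 < p / (p - 1) by rewrite divr_gt0.
have pq : p^-1 + (p / (p - 1))^-1 = 1 by field; rewrite !gt_eqF.
have := conjugate_powR t0 (powR_ge0 s (p - 1)) p0 q0 pq.
have -> : (s `^ (p - 1)) `^ (p / (p - 1)) = s `^ p.
  by rewrite -powRrM; congr (_ `^ _); field; rewrite gt_eqF.
rewrite -(ler_pM2l p0).
have -> : p * (t `^ p / p + s `^ p / (p / (p - 1))) = t `^ p + (p - 1) * s `^ p.
  by field; rewrite !gt_eqF.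
have := mulr_powRB1 s0 p0.
move: (s `^ (p - 1)) (s `^ p) (t `^ p) => a b c <-; lra.
Qed.

(* Going through the intermediate point [m * G], with [r < m < 1], turns the
   tangent inequality into a uniformly strict one. *)
Lemma powR_tangent_gap p r : 1 < p -> 0 <= r -> r < 1 -> exists2 c, 0 < c &
  forall s G, 0 <= s -> s <= r * G -> 0 <= G ->
    s `^ p + p * s `^ (p - 1) * (G - s) + c * G `^ p <= G `^ p.
Proof.
move=> p1 r0 r1.
have [m rm m1] : exists2 m, r < m & m < 1 by exists ((1 + r) / 2); lra.
have p0 : 0 < p by lra.
have pB0 : 0 < p - 1 by lra.
have m0 : 0 <= m by lra.
have rmp : r `^ (p - 1) < m `^ (p - 1) by apply: gt0_ltr_powR; rewrite ?nnegrE.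
(* The tangent inequalities at s and at m G are chained. Over the interval from m G to G, of length
   (1 - m) G, the slope at m G replaces the slope at s, which is at most the slope at r G. *)
exists (p * (m `^ (p - 1) - r `^ (p - 1)) * (1 - m)).
  by rewrite !mulr_gt0// subr_gt0.
move=> s G s0 srG G0.
have mG0 : 0 <= m * G by rewrite mulr_ge0.
have h1 := powR_tangent p1 mG0 G0.
have h2 := powR_tangent p1 s0 mG0.
have h3 : s `^ (p - 1) <= r `^ (p - 1) * G `^ (p - 1).
  by rewrite -powRM//; apply: ge0_ler_powR; rewrite ?nnegrE ?mulr_ge0//; lra.
rewrite !powRM// in h1 h2.
have pmG0 : 0 <= p * (1 - m) * G.
  by apply: mulr_ge0 => //; apply: mulr_ge0; lra.
have := ler_wpM2l pmG0 h3.
have Gp := mulr_powRB1 G0 p0.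
have mp := mulr_powRB1 m0 p0.
rewrite -Gp -mp in h1 h2; rewrite -Gp.
move: h1 h2.
move: (s `^ p) (s `^ (p - 1)) (m `^ (p - 1)) (r `^ (p - 1)) (G `^ (p - 1)).
by move=> a b c' d' g h1 h2 h; lra.
Qed.
End powR_tangent.

(** * Sign vectors and seminorms on R^n *)

Section seminorm.
Context {R : realType} {n : nat}.
Implicit Types (y : 'rV[R]_n) (e : {ffun 'I_n -> bool}).

Definition sign_vector e : 'rV[R]_n := \row_j (-1) ^+ e j.

Lemma linf_norm_ge0 y : 0 <= linf_norm y.
Proof. by apply: bigmax_ge_id. Qed.

Lemma le_linf_norm y i : `|y ord0 i| <= linf_norm y.
Proof. exact: le_bigmax. Qed.

Lemma linf_norm_le y M : 0 <= M -> (forall i, `|y ord0 i| <= M) ->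
  linf_norm y <= M.
Proof. by move=> M0 yM; apply: bigmax_le. Qed.

Lemma linf_norm_attained y : (0 < n)%N ->
  exists i, linf_norm y = `|y ord0 i|.
Proof.
move=> n0; have i0 : 'I_n by exact: (Ordinal n0).
by rewrite /linf_norm (bigmax_eq_arg _ i0)//; eexists.
Qed.

Lemma linf_norm_delta i : linf_norm (delta_mx ord0 i : 'rV[R]_n) = 1.
Proof.
apply/le_anti/andP; split.
  apply: linf_norm_le => // j; rewrite mxE/=.
  by case: eqP => _; rewrite ?normr1 ?normr0.
by apply: le_trans (le_linf_norm _ i); rewrite mxE !eqxx normr1.
Qed.

Lemma linf_norm_sign_vector e : linf_norm (sign_vector e) <= 1.
Proof. by apply: linf_norm_le => // j; rewrite mxE normr_sign. Qed.

(** In a coordinate j other than i, flipping the sign at j pairs the terms into opposites; in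
    coordinate i every term equals 1. *)
Lemma sum_sign_vector i :
  \sum_(e : {ffun 'I_n -> bool}) (-1) ^+ e i *: sign_vector e =
  #|{ffun 'I_n -> bool}|%:R *: delta_mx ord0 i :> 'rV[R]_n.
Proof.
apply/rowP => j; rewrite summxE !mxE eqxx/=.
have [->|ji] := eqVneq j i.
  under eq_bigr do rewrite !mxE -expr2 sqrr_sign.
  by rewrite sumr_const mulr1.
rewrite mulr0.
pose flip e := [ffun k => if k == j then ~~ e k else e k].
have flipK : involutive flip.
  move=> e; apply/ffunP => k; rewrite !ffunE.
  by case: eqP => // _; rewrite negbK.
set S := LHS; suff : S = - S by move=> h; lra.
rewrite {1}/S (reindex_inj (inv_inj flipK))/= /S -sumrN.
apply: eq_bigr => e _; rewrite !mxE !ffunE eqxx eq_sym (negbTE ji).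
by case: (e j); rewrite ?expr0 ?expr1; lra.
Qed.

Variables (N : 'rV[R]_n -> R).
Hypothesis ND : forall u v, N (u + v) <= N u + N v.
Hypothesis NZ : forall a u, N (a *: u) = `|a| * N u.

Lemma seminorm0 : N 0 = 0.
Proof. by rewrite -(scale0r 0) NZ normr0 mul0r. Qed.

Lemma seminorm_ge0 u : 0 <= N u.
Proof.
have := ND u (- u); rewrite subrr seminorm0 -scaleN1r NZ normrN1 mul1r; lra.
Qed.

Lemma seminorm_sum (I : Type) (s : seq I) (F : I -> 'rV[R]_n) :
  N (\sum_(i <- s) F i) <= \sum_(i <- s) N (F i).
Proof.
elim/big_rec2 : _ => [|i y1 y2 _ h]; first by rewrite seminorm0.
by apply: le_trans (ND _ _) _; rewrite lerD2l.
Qed.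

Lemma seminorm_delta_le_sum i :
  #|{ffun 'I_n -> bool}|%:R * N (delta_mx ord0 i) <=
    \sum_(e : {ffun 'I_n -> bool}) N (sign_vector e).
Proof.
have := seminorm_sum (index_enum _) (fun e => (-1) ^+ e i *: sign_vector e).
rewrite sum_sign_vector NZ normr_nat => /le_trans; apply.
by apply: ler_sum => e _; rewrite NZ normr_sign mul1r.
Qed.

(* The sign vectors are the extreme points of the unit ball of ell_infty^n:
   coordinates are pushed to +1 or -1 one at a time. *)
Lemma seminorm_le_sign G : (forall e, N (sign_vector e) <= G) ->
  forall y, N y <= G * linf_norm y.
Proof.
move=> NG.
suff cube y : (forall i, `|y ord0 i| <= 1) -> N y <= G.
  move=> y; have := linf_norm_ge0 y; rewrite le_eqVlt => /predU1P[y0|y0].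
    suff -> : y = 0.
      rewrite seminorm0 mulr_ge0 ?linf_norm_ge0//.
      exact: le_trans (seminorm_ge0 _) (NG [ffun=> true]).
    apply/rowP => i; rewrite !mxE; apply/normr0_eq0/le_anti.
    by rewrite normr_ge0 y0 le_linf_norm.
  rewrite -ler_pdivrMr// mulrC -(gtr0_norm y0) -normfV -NZ.
  apply: cube => i; rewrite mxE normrM normfV (gtr0_norm y0).
  by rewrite ler_pdivrMl// mulr1 le_linf_norm.
(* Coordinates of index at least [k] already have modulus 1: no condition for k = n, a sign vector
   for k = 0. *)
suff H k : (k <= n)%N -> forall y, (forall i, `|y ord0 i| <= 1) ->
    (forall i : 'I_n, (k <= i)%N -> `|y ord0 i| = 1) -> N y <= G.
  by move=> y1; apply: (H n) => // i; rewrite leqNgt ltn_ord.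
elim: k => [_ {}y _ y1|k IH kn {}y y1 yk].
  suff -> : y = sign_vector [ffun i => y ord0 i < 0] by [].
  apply/rowP => i; rewrite !mxE ffunE; have := y1 i isT.
  by case: ltP => y0; [rewrite ltr0_norm// => h|rewrite ger0_norm// => h];
    rewrite ?expr0 ?expr1; lra.
pose j := Ordinal kn.
pose z (a : R) : 'rV[R]_n := \row_i (if i == j then a else y ord0 i).
have zG a : `|a| = 1 -> N (z a) <= G.
  move=> a1; apply: IH => [|i|i ki]; first exact: ltnW.
    by rewrite mxE; case: eqP => _ //; rewrite a1.
  rewrite mxE; case: eqP => // /eqP ij; apply: yk.
  by rewrite ltn_neqAle ki andbT; apply: contra ij => /eqP ij;
    apply/eqP/val_inj.
(* [y] is a convex combination of the two points obtained by setting its coordinate [j] to 1 and to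
   -1. *)
have -> : y = ((1 + y ord0 j) / 2) *: z 1 + ((1 - y ord0 j) / 2) *: z (- 1).
  apply/rowP => i; rewrite !mxE; case: eqP => [->|_]; lra.
have := y1 j; rewrite ler_norml => /andP[yl yr].
apply: (le_trans (ND _ _)); rewrite !NZ !ger0_norm; [|lra..].
have := ler_wpM2l (_ : 0 <= (1 + y ord0 j) / 2) (zG 1 (normr1 _)).
have := ler_wpM2l (_ : 0 <= (1 - y ord0 j) / 2) (zG (-1) (normrN1 _)).
move=> /(_ ltac:(lra)) h1 /(_ ltac:(lra)) h2; lra.
Qed.

(* If [|y_i| = ||y||] then [2 y_i e_i - y] has norm at most [||y||]. *)
Lemma seminorm_ge_delta G r : (0 < n)%N ->
  (forall e, N (sign_vector e) <= G) ->
  (forall i, r * G <= N (delta_mx ord0 i)) ->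
  forall y, (2 * r - 1) * G * linf_norm y <= N y.
Proof.
move=> n0 NG NrG y; have [i yi] := linf_norm_attained y n0.
pose z := (2 * y ord0 i) *: delta_mx ord0 i - y.
have zy : linf_norm z <= linf_norm y.
  apply: linf_norm_le => [|j]; first exact: linf_norm_ge0.
  rewrite !mxE/=; case: eqP => [->|_].
    by rewrite yi mulr1 (_ : _ - _ = y ord0 i)//; lra.
  by rewrite mulr0 sub0r normrN le_linf_norm.
have Nz : N z <= G * linf_norm y.
  apply: le_trans (seminorm_le_sign NG z) _; apply: ler_wpM2l zy.
  exact: le_trans (seminorm_ge0 _) (NG [ffun=> true]).
(* Since y + z = 2 y_i e_i, subadditivity gives 2 |y_i| N(e_i) <= N(y) + N(z). *)
have := ND y z; rewrite addrC subrK NZ normrM normr_nat -yi.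
have := ler_wpM2l (linf_norm_ge0 y) (NrG i); lra.
Qed.
End seminorm.

(** * Averaging over the sign vectors, with a gain *)

Section seminorm_powR.
Context {R : realType}.

(** The tangent inequalities at [s] are summed over [S]. Their linear terms have a nonnegative total
    because the mean of [t] is at least [s], and the index [k0] contributes the surplus [g]. *)
Lemma sum_powR_tangent (S : finType) (t : S -> R) (k0 : S) (p s g : R) :
  1 < p -> 0 <= s -> (forall k, 0 <= t k) ->
  #|S|%:R * s <= \sum_k t k ->
  s `^ p + p * s `^ (p - 1) * (t k0 - s) + g <= t k0 `^ p ->
  #|S|%:R * s `^ p + g <= \sum_k t k `^ p.
Proof.
move=> p1 s0 t0 st gt.
pose l k := s `^ p + p * s `^ (p - 1) * (t k - s).
have -> : \sum_k t k `^ p = t k0 `^ p + \sum_(k | k != k0) t k `^ p.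
  by rewrite (bigD1 k0).
suff h : #|S|%:R * s `^ p <= \sum_k l k.
  apply: (@le_trans _ _ (\sum_k l k + g)); first by rewrite lerD2r.
  rewrite (bigD1 k0)//= addrAC lerD//.
  by apply: ler_sum => k _; apply: powR_tangent.
rewrite big_split/= -mulr_sumr sumrB !sumr_const -(mulr_natl (s `^ p)).
rewrite -(mulr_natl s) lerDl mulr_ge0 ?subr_ge0//.
by rewrite mulr_ge0 ?powR_ge0//; lra.
Qed.

(** The constant [c] is chosen before [N], so one constant serves the seminorms at all points of M
    and the inequality can be integrated. A single deficient coordinate [i] supplies the gain; the
    others use the plain tangent inequality. *)
Lemma seminorm_powR_gap (n : nat) (p r : R) :
  (0 < n)%N -> 1 < p -> 0 <= r -> r < 1 ->
  exists2 c, 0 < c & forall N : 'rV[R]_n -> R,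
    (forall u v, N (u + v) <= N u + N v) ->
    (forall a u, N (a *: u) = `|a| * N u) ->
    forall i e0, (forall e, N (sign_vector e) <= N (sign_vector e0)) ->
    N (delta_mx ord0 i) <= r * N (sign_vector e0) ->
    (#|{ffun 'I_n -> bool}|%:R + c) * \sum_i N (delta_mx ord0 i) `^ p <=
    n%:R * \sum_(e : {ffun 'I_n -> bool}) N (sign_vector e) `^ p.
Proof.
move=> n0 p1 r0 r1; have [c c0 gap] := powR_tangent_gap p1 r0 r1.
have nR : 0 < n%:R :> R by rewrite ltr0n.
(* Each N(e_j)^p is at most G^p, so the gain c G^p dominates c / n times their sum. *)
exists (c / n%:R); first by rewrite divr_gt0.
move=> N ND NZ i0 e0 Ne0 Nr.
have N0 := seminorm_ge0 ND NZ.
set K := #|_|%:R; set G := N (sign_vector e0) in Ne0 Nr *.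
set S := \sum_(e : {ffun _}) _.
have NG i : N (delta_mx ord0 i) `^ p <= G `^ p.
  apply: ge0_ler_powR; rewrite ?nnegrE ?N0//; first lra.
  have := seminorm_le_sign ND NZ Ne0 (delta_mx ord0 i).
  by rewrite linf_norm_delta mulr1.
have avg i := sum_powR_tangent (t := fun e => N (sign_vector e)) (k0 := e0)
  p1 (N0 _) (fun e => N0 _) (seminorm_delta_le_sum ND NZ i).
have KS i : K * N (delta_mx ord0 i) `^ p <= S.
  rewrite -[X in X <= _]addr0; apply: avg.
  by rewrite addr0 powR_tangent.
have KSi0 : K * N (delta_mx ord0 i0) `^ p + c * G `^ p <= S.
  by apply: avg; apply: gap.
have h1 : K * \sum_i N (delta_mx ord0 i) `^ p + c * G `^ p <= n%:R * S.
  rewrite (bigD1 i0)//= mulrDr addrAC.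
  have -> : n%:R * S = S + \sum_(i < n | i != i0) S.
    by rewrite mulr_natl -{1}(card_ord n) -sumr_const (bigD1 i0).
  by rewrite lerD// mulr_sumr ler_sum.
have h2 : \sum_i N (delta_mx ord0 i) `^ p <= n%:R * G `^ p.
  have -> : n%:R * G `^ p = \sum_(i < n) G `^ p.
    by rewrite sumr_const card_ord mulr_natl.
  exact: ler_sum.
apply: le_trans h1; rewrite mulrDl lerD2l mulrAC ler_pdivrMr//.
by rewrite -mulrA ler_wpM2l ?(ltW c0)// mulrC.
Qed.

End seminorm_powR.

(** * Measurability of norms, and Bochner norms as integrals *)

Lemma lee_poweR2r {R : realType} (p : R) (x y : \bar R) : 0 < p ->
  (0 <= x -> 0 <= y -> (x `^ p <= y `^ p) = (x <= y))%E.
Proof.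
move=> p0 x0 y0.
have homo (q : R) (u v : \bar R) : 0 <= q ->
    (0 <= u -> 0 <= v -> u <= v -> u `^ q <= v `^ q)%E.
  by move=> q0 u0 v0; apply: gt0_ler_poweR; rewrite // in_itv/= ?u0 ?v0 leey.
apply/idP/idP; last exact: homo (ltW p0) x0 y0.
have pV0 : 0 <= p^-1 by rewrite invr_ge0 ltW.
move/(homo _ _ _ pV0 (poweR_ge0 _ _) (poweR_ge0 _ _)).
by rewrite -!poweRrM divff ?gt_eqF// !poweRe1.
Qed.

Section measurable_norm.
Context {d} {M : measurableType d} {R : realType} {X : normedModType R}.

Lemma simple_fun_measurable_norm (g : M -> X) :
  simple_fun g -> measurable_fun setT (fun x => `|g x|).
Proof.
move=> [s [ms ->]].
suff H w : measurable_fun setT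
    (* The offset [w] makes the induction work: on the first set of the list, its vector is absorbed
       into [w]. *)
    (fun x => `|w + \sum_(j <- s) (\1_(j.1) x : R) *: j.2|).
  by have := H 0; under eq_fun do rewrite add0r.
elim: s ms w => [_ w|[B v] s IH ms w].
  under eq_fun do rewrite big_nil.
  exact: measurable_cst.
have mB : measurable B by apply: (ms (B, v)); rewrite mem_head.
have {}IH := IH (fun j js => ms j (mem_behead (s := _ :: _) js)).
rewrite (_ : (fun x => _) = (fun x => if x \in B
    then `|(w + v) + \sum_(j <- s) (\1_(j.1) x : R) *: j.2|
    else `|w + \sum_(j <- s) (\1_(j.1) x : R) *: j.2|)); last first.
  apply/funext => x; rewrite big_cons/= indicE.
  by case: (x \in B); rewrite ?scale1r ?scale0r ?add0r// addrA.
apply: measurable_fun_ifT; [|exact: IH|exact: IH].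
apply: (measurable_fun_bool true); rewrite setTI (_ : _ @^-1` _ = B)//.
  by apply/seteqP; split => x; [exact: set_mem|exact: mem_set].
Qed.

Lemma strongly_measurable_norm (f : M -> X) :
  strongly_measurable f -> measurable_fun setT (fun x => `|f x|).
Proof.
move=> [g [sg gf]].
apply: (@measurable_fun_cvg _ _ _ _ (fun k x => `|g k x|)).
  by move=> k; exact: simple_fun_measurable_norm.
by move=> x _; apply: cvg_norm; exact: gf.
Qed.

Lemma simple_fun_strongly_measurable (f : M -> X) :
  simple_fun f -> strongly_measurable f.
Proof. by move=> sf; exists (fun=> f); split => // x; exact: cvg_cst. Qed.

Lemma strongly_measurable_powR (p : R) (f : M -> X) :
  strongly_measurable f -> measurable_fun setT (fun x => (`|f x| `^ p)%:E).
Proof.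
move=> /strongly_measurable_norm mf; apply/measurable_EFinP.
exact: (measurableT_comp (measurable_powR p)).
Qed.

Variable mu : {measure set M -> \bar R}.

Lemma bochner_norm_powR (p : R) (f : M -> X) : p != 0 ->
  (bochner_norm mu p f `^ p = \int[mu]_x (`|f x| `^ p)%:E)%E.
Proof.
move=> p0; rewrite /bochner_norm (powR_Lnorm mu _ p0).
by apply: eq_integral => x _; rewrite abse_EFin normr_id poweR_EFin.
Qed.

Lemma bochner_norm_le (p : R) (f : M -> X) (a : R) : 0 < p -> 0 <= a ->
  (bochner_norm mu p f <= a%:E)%E =
  (\int[mu]_x (`|f x| `^ p)%:E <= (a `^ p)%:E)%E.
Proof.
move=> p0 a0; rewrite -bochner_norm_powR ?gt_eqF// -poweR_EFin.
by rewrite lee_poweR2r ?Lnorm_ge0.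
Qed.

Lemma bochner_norm_ge (p : R) (f : M -> X) (a : R) : 0 < p -> 0 <= a ->
  (a%:E <= bochner_norm mu p f)%E =
  ((a `^ p)%:E <= \int[mu]_x (`|f x| `^ p)%:E)%E.
Proof.
move=> p0 a0; rewrite -bochner_norm_powR ?gt_eqF// -poweR_EFin.
by rewrite lee_poweR2r ?Lnorm_ge0.
Qed.

End measurable_norm.

(** * From X to the Lebesgue-Bochner space *)

Lemma linf_representable_Lp_of {R : realType} (X : normedModType R)
    {d} {M : measurableType d} (mu : {measure set M -> \bar R}) (A : set M)
    (p : R) (n : nat) :
  measurable A -> (0 < mu A)%E -> (mu A < +oo)%E -> 1 < p ->
  linf_representable n X -> linf_representable_Lp n X mu p.
Proof.
move=> mA A0 Aoo p1 HX lam lam1; have [T [linT TE]] := HX _ lam1.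
have p0 : 0 < p by lra.
have [a a0 muA] : exists2 a : R, 0 < a & mu A = a%:E.
  exists (fine (mu A)); last by rewrite fineK ?ge0_fin_numE// ltW.
  by rewrite fine_gt0// A0.
(* With this normalization c 1_A has norm 1 in L_p, so [U y] has the same norm as [T y]. *)
pose c := (a `^ p^-1)^-1.
have aP : 0 < a `^ p^-1 by rewrite powR_gt0.
have c0 : 0 < c by rewrite invr_gt0.
have cp : c `^ p * a = 1.
  rewrite -[X in _ * X](_ : (a `^ p^-1) `^ p = a); last first.
    by rewrite -powRrM mulVf ?gt_eqF// powRr1// ltW.
  by rewrite -powRM ?ltW// mulVf ?gt_eqF// powR1.
pose U y := fun x => (\1_A x : R) *: (c *: T y).
have intU y : (\int[mu]_x (`|U y x| `^ p)%:E = (`|T y| `^ p)%:E)%E.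
  transitivity (\int[mu]_x (((c * `|T y|) `^ p)%:E * (\1_A x)%:E))%E.
    apply: eq_integral => x _; rewrite -EFinM /U !normrZ indicE (gtr0_norm c0).
    case: (x \in A); first by rewrite normr1 mul1r mulr1.
    by rewrite normr0 mul0r mulr0 powR0 ?gt_eqF.
  rewrite ge0_integralZl_EFin ?powR_ge0//; last exact/measurable_EFinP.
  rewrite integral_indic// setIT muA -EFinM powRM ?(ltW c0)//.
  by rewrite mulrAC cp mul1r.
have bU y b : 0 <= b -> (bochner_norm mu p (U y) <= b%:E)%E = (`|T y| <= b).
  move=> b0; rewrite bochner_norm_le// intU -!poweR_EFin.
  by rewrite lee_poweR2r ?lee_fin.
have Ub y b : 0 <= b -> (b%:E <= bochner_norm mu p (U y))%E = (b <= `|T y|).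
  move=> b0; rewrite bochner_norm_ge// intU -!poweR_EFin.
  by rewrite lee_poweR2r ?lee_fin.
exists U; split; [|split].
- move=> y; split.
    apply: simple_fun_strongly_measurable; exists [:: (A, c *: T y)].
    split; first by move=> j; rewrite inE => /eqP ->.
    by apply/funext => x; rewrite big_seq1.
  by apply: le_lt_trans (ltry `|T y|); rewrite bU.
- move=> b u v; apply/funext => x; rewrite /U linT.
  by rewrite !scalerDr !scalerA; congr (_ *: _ + _); ring.
- move=> y; have /andP[h1 h2] := TE y.
  have L0 := linf_norm_ge0 y.
  by rewrite Ub// bU ?h1 ?h2// mulr_ge0//; lra.
Qed.

(** * From the Lebesgue-Bochner space to X *)

Lemma linf_representable_of_Lp {R : realType} (X : normedModType R)
    {d} {M : measurableType d} (mu : {measure set M -> \bar R})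
    (p : R) (n : nat) :
  (0 < n)%N -> 1 < p ->
  linf_representable_Lp n X mu p -> linf_representable n X.
Proof.
move=> n0 p1 HLp lam lam1; have p0 : 0 < p by lra.
have lamV : 0 < lam^-1 by rewrite invr_gt0; lra.
have lamV1 : lam^-1 < 1 by rewrite invf_lt1//; lra.
(* Chosen so that 2 r - 1 = 1 / lam, the lower constant of the seminorm estimate. *)
pose r := (1 + lam^-1) / 2.
have r0 : 0 <= r by rewrite /r; lra.
have r1 : r < 1 by rewrite /r; lra.
have [c c0 gap] := seminorm_powR_gap n0 p1 r0 r1.
set K : R := #|_|%:R in gap.
have K0 : 0 < K by rewrite ltr0n; apply/card_gt0P; exists [ffun=> true].
(* K q = K + c / 2 stays below K + c. The embedding constant is taken as q^(1/p), so the integrals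
   of the p-th powers at sign vectors are at most [q]. *)
pose q := 1 + c / K / 2.
have q1 : 1 < q by rewrite /q ltrDl !divr_gt0.
have lam'1 : 1 < q `^ p^-1.
  have <- : 1 `^ p^-1 = 1 :> R by rewrite powR1.
  by apply: gt0_ltr_powR; rewrite ?nnegrE ?invr_gt0//; lra.
have [T [LT [linT TE]]] := HLp _ lam'1.
pose N x y := `|T y x|.
(* Linearity of [T] holds at every point, so [N x] is a seminorm for each [x], with no exceptional
   null set. *)
have ND x u v : N x (u + v) <= N x u + N x v.
  by rewrite /N -[u]scale1r linT !scale1r ler_normD.
have T0 x : T 0 x = 0.
  have := congr1 (fun f => f x) (linT 1 0 0).
  rewrite /= scaler0 addr0 scale1r => /(congr1 (fun z => z - T 0 x)).
  by rewrite subrr addrK.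
have TZ x a u : T (a *: u) x = a *: T u x.
  by rewrite -[a *: u]addr0 linT T0 addr0.
have NZ x a u : N x (a *: u) = `|a| * N x u by rewrite /N TZ normrZ.
(* Either at some [x] every coordinate exceeds r G, and that point gives the embedding, or every [x]
   has a deficient coordinate and the gap can be integrated. *)
have [[x Nx]|] := pselect (exists x, forall i e0,
    (forall e, N x (sign_vector e) <= N x (sign_vector e0)) ->
    r * N x (sign_vector e0) < N x (delta_mx ord0 i)).
  have [e0 NG] : exists e0, forall e,
      N x (sign_vector e) <= N x (sign_vector e0).
    pose f e := N x (sign_vector e).
    case: (@arg_maxP _ _ _ [ffun=> true] xpredT f isT) => // e0 _ h.
    by exists e0 => e; apply: h.
  have {}Nx i := Nx i _ NG.
  set G := N x (sign_vector e0) in NG Nx.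
  have up := seminorm_le_sign (ND x) (NZ x) NG.
  have down := seminorm_ge_delta (ND x) (NZ x) n0 NG (fun i => ltW (Nx i)).
  have G0 : 0 < G.
    have i0 := Ordinal n0.
    have := up (delta_mx ord0 i0); rewrite linf_norm_delta mulr1.
    have : 0 <= r * G by rewrite mulr_ge0 ?(seminorm_ge0 (ND x) (NZ x)).
    by have := Nx i0; lra.
  have rl : 2 * r - 1 = lam^-1 by rewrite /r; lra.
  rewrite rl in down.
  (* The factor lam / G turns the bounds G |y| / lam and G |y| into |y| and lam |y|. *)
  exists (fun y => (lam / G) *: T y x); split.
    move=> a u v; rewrite linT scalerDr !scalerA; congr (_ *: _ + _); ring.
  move=> y; rewrite normrZ ger0_norm; last by rewrite divr_ge0//; lra.
  rewrite -/(N x y); apply/andP; split.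
    have -> : linf_norm y = lam / G * (lam^-1 * G * linf_norm y).
      by field; rewrite !gt_eqF//; lra.
    by rewrite ler_wpM2l// divr_ge0//; lra.
  rewrite -mulrA ler_wpM2l//; first lra.
  by rewrite ler_pdivrMl.
move=> /forallNP H; exfalso.
pose I y := (\int[mu]_x (N x y `^ p)%:E)%E.
have mI y : measurable_fun setT (fun x => (N x y `^ p)%:E).
  by apply: strongly_measurable_powR; case: (LT y).
have I1 i : (1 <= I (delta_mx ord0 i))%E.
  have /andP[h _] := TE (delta_mx ord0 i); move: h.
  by rewrite linf_norm_delta bochner_norm_ge// powR1.
have Iq e : (I (sign_vector e) <= q%:E)%E.
  have /andP[_ h] := TE (sign_vector e).
  have : (bochner_norm mu p (T (sign_vector e)) <= (q `^ p^-1)%:E)%E.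
    apply: (le_trans h); rewrite lee_fin ler_piMr ?powR_ge0//.
    exact: linf_norm_sign_vector.
  rewrite bochner_norm_le ?powR_ge0// -powRrM mulVf ?gt_eqF// powRr1//; lra.
have Igap : ((K + c)%:E * \sum_i I (delta_mx ord0 i) <=
    n%:R%:E * \sum_(e : {ffun 'I_n -> bool}) I (sign_vector e))%E.
  rewrite -!ge0_integral_sum//; [|by move=> *; rewrite lee_fin powR_ge0..].
  have mS (J : finType) (u : J -> 'rV[R]_n) : measurable_fun setT
      (fun x => \sum_j (N x (u j) `^ p)%:E)%E by exact: emeasurable_sum.
  have S0 (J : finType) (u : J -> 'rV[R]_n) x :
      (0 <= \sum_j (N x (u j) `^ p)%:E)%E.
    by apply: sume_ge0 => j _; rewrite lee_fin powR_ge0.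
  rewrite -!ge0_integralZl_EFin//; last by rewrite addr_ge0// ltW.
  apply: ge0_le_integral => //.
  - by move=> x _; rewrite mule_ge0// lee_fin addr_ge0// ltW.
  - exact: measurable_funeM.
  - exact: measurable_funeM.
  move=> x _; rewrite !sumEFin -!EFinM lee_fin.
  have /existsNP[i /existsNP[e0 /not_implyP[NG /negP]]] := H x.
  by rewrite -leNgt; apply: gap.
(* Inserting [I1] and [Iq] into [Igap] gives K + c <= K q = K + c / 2, which is absurd. *)
have : ((K + c)%:E * n%:R%:E <= n%:R%:E * (K * q)%:E)%E.
  apply: le_trans (le_trans Igap _).
    apply: lee_wpmul2l; first by rewrite lee_fin addr_ge0// ltW.
    rewrite -[n in leLHS]card_ord -sumr_const -sumEFin.
    by apply: lee_sum.
  apply: lee_wpmul2l => //.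
  rewrite /K mulr_natl -sumr_const -sumEFin.
  by apply: lee_sum.
rewrite -!EFinM lee_fin mulrC ler_pM2l ?ltr0n// /q.
have -> : K * (1 + c / K / 2) = K + c / 2 by field; rewrite gt_eqF.
lra.
Qed.

Theorem theorem2p3 (R : realType) (X : completeNormedModType R)
    (d : measure_display) (M : measurableType d)
    (mu : {measure set M -> \bar R}) (A : set M)
    (mA : measurable A) (hA0 : (0 < mu A)%E) (hAfin : (mu A < +oo)%E)
    (p : R) (hp : 1 < p) (n : nat) (hn : (2 <= n)%N) :
  linf_representable n X <-> linf_representable_Lp n X mu p.
Proof.
split; first exact: (linf_representable_Lp_of mA).
exact: linf_representable_of_Lp (ltnW hn) hp.
Qed.
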